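(* Let $(\varrho^s_X,\pi^s)\in\Gamma(\mathcal X)\times\Pi_0(\mathcal X,\mathcal U)$ be a stationary distribution–policy pair with $(X^s,\pi^s(X^s))\in\mathbb Y$ for $X^s\sim\varrho^s_X$, and let the stochastic optimal control problem be distributionally dissipative at $(\varrho^s_X,\pi^s)$ with respect to a metric $d_D$ on $\mathcal P_n(\mathcal X)$. Then $(\varrho^s_X,\pi^s)$ is an optimal solution of $$\min_{\pi,\varrho_X}\ \ell(X,U)\quad\text{s.t.}\quad X\sim\varrho_X,\ U=\pi(X),\ \varrho_X=\mathcal T(\varrho_X,\pi),\ (X,\pi(X))\in\mathbb Y,$$ the minimum being over $(\varrho_X,\pi)\in\Gamma(\mathcal X)\times\Pi_0(\mathcal X,\mathcal U)$. Moreover, if the problem is strictly distributionally dissipative at $(\varrho^s_X,\pi^s)$ with respect to $d_D$, then $\varrho^s_X$ is the unique (partial) solution of this problem, i.e. for every other solution $(\tilde\varrho^s_X,\tilde\pi^s)\in\Gamma(\mathcal X)\times\Pi_0(\mathcal X,\mathcal U)$ one has $d_D(\varrho^s_X,\tilde\varrho^s_X)=0$.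
   Context: Setting. $\mathcal X,\mathcal U,\mathcal W$ are separable Banach spaces, $\|\cdot\|$ is the norm of $\mathcal X$, $(\Omega,\mathcal F,\mathbb P)$ is a probability space, $n,l\ge 1$ are fixed exponents, and $L^n(\Omega,\mathcal F,\mathbb P;\mathcal X)$ is the space of $\mathcal X$-valued random variables with finite $n$-th moment. $f:\mathcal X\times\mathcal U\times\mathcal W\to\mathcal X$ is continuous in $(x,u)$ for almost all $w$. The control system is $X(k+1)=f(X(k),U(k),W(k))$, $X(0)=X_0$, where $(W(0),W(1),\dots)$ is i.i.d. with distribution $\varrho_W$ and $W(k)$ is independent of $(X(k),U(k))$. The constraint set $\mathbb Y\subseteq L^n(\Omega,\mathcal F,\mathbb P;\mathcal X)\times L^l(\Omega,\mathcal F,\mathbb P;\mathcal U)$ is law-invariant (if $(X,U)\in\mathbb Y$ and $(Y,V)$ has the same joint law as $(X,U)$, then $(Y,V)\in\mathbb Y$). The stage cost $\ell:\mathbb Y\to\mathbb R$ is law-invariant ($\ell(X,U)$ depends only on the joint law of $(X,U)$). The stochastic optimal control problem is to minimize $\sum_{k=0}^{N-1}\ell(X(k),U(k))$ over controls of Markov policy form $U(k)=\pi_k(X(k))$, $\pi_k\in\Pi_0(\mathcal X,\mathcal U)$, satisfying the constraints $(X(k),U(k))\in\mathbb Y$. Notation. $\mathcal P(\mathcal X)$ is the set of Borel probability measures on $\mathcal X$, $\mathcal P_n(\mathcal X)$ the subset of those with finite $n$-th moment, $\Gamma(\mathcal X):=\{\varrho\in\mathcal P_n(\mathcal X):\exists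 X\in L^n(\Omega,\mathcal F,\mathbb P;\mathcal X),\ X\sim\varrho\}$. $P_X$ is the law of $X$. $\Pi_0(\mathcal X,\mathcal U)$ is the set of (measurable) maps $\pi:\mathcal X\to\mathcal U$ with $\pi\circ X\in L^l(\Omega,\mathcal F,\mathbb P;\mathcal U)$ for all $X\in L^n(\Omega,\mathcal F,\mathbb P;\mathcal X)$. For $\varrho\in\mathcal P_n(\mathcal X)$ and $\pi\in\Pi_0(\mathcal X,\mathcal U)$, $\mathcal T(\varrho,\pi)$ is the law of $f(X,\pi(X),W)$, where $X\sim\varrho$ and $W\sim\varrho_W$ are independent. The pair $(\varrho^s_X,\pi^s)$ is stationary if $\mathcal T(\varrho^s_X,\pi^s)=\varrho^s_X$. $\mathcal K_\infty$ is the set of continuous, strictly increasing, unbounded $\alpha:[0,\infty)\to[0,\infty)$ with $\alpha(0)=0$. Strict distributional dissipativity at $(\varrho^s_X,\pi^s)$ with respect to a metric $d_D$ on $\mathcal P_n(\mathcal X)$: there exist $\Lambda:\mathcal P(\mathcal X)\to\mathbb R$ bounded from below and $\alpha\in\mathcal K_\infty$ such that $$\ell(X,\pi(X))-\ell(X^s,\pi^s(X^s))+\Lambda(P_X)-\Lambda(P_{X^+})\ \ge\ \alpha(d_D(P_X,\varrho^s_X))$$ for all $(X,\pi(X))\in\mathbb Y$ with $\pi\in\Pi_0(\mathcal X,\mathcal U)$ and all $X^s\sim\varrho^s_X$, where $P_{X^+}=\mathcal T(P_X,\pi)$ is the law of $X^+=f(X,\pi(X),W)$. Distributional dissipativity is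 the same with $\alpha\equiv0$. *)

(* Defs.v *)
From HB Require Import structures.
From mathcomp Require Import all_boot all_order all_algebra.
From mathcomp Require Import finmap.
From mathcomp Require Import all_classical all_reals all_analysis.
From mathcomp Require Import giry.
Set Implicit Arguments.
Unset Strict Implicit.
Unset Printing Implicit Defensive.
Import Order.TTheory GRing.Theory Num.Theory.
Import numFieldNormedType.Exports.
Local Open Scope classical_set_scope.
Local Open Scope ring_scope.

(* The carrier of T with its Borel sigma-algebra. It is convertible to T, but
   has no norm or topology of its own: casts back to T appear below wherever
   these are used. On separable spaces the product sigma-algebra of
   borel T1 * borel T2 is the Borel sigma-algebra of T1 * T2. *)
Definition borel (T : ptopologicalType) := g_sigma_algebraType (@open T).

Definition separable_space (T : topologicalType) : Prop :=
  exists A : set T, countable A /\ dense A.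

Section pairing.
Context d d1 d2 (T : measurableType d) (T1 : measurableType d1)
  (T2 : measurableType d2).

Definition pair_fun (X : T -> T1) (Y : T -> T2) (t : T) : T1 * T2 := (X t, Y t).

Variables (X : {mfun T >-> T1}) (Y : {mfun T >-> T2}).

Let pair_fun_measurable : measurable_fun [set: T] (pair_fun X Y).
Proof. by apply: measurable_fun_pair. Qed.

HB.instance Definition _ :=
  isMeasurableFun.Build _ _ _ _ (pair_fun X Y) pair_fun_measurable.

Definition mpair : {mfun T >-> (T1 * T2)%type} := pair_fun X Y.

End pairing.

Section projections.
Context d1 d2 (T1 : measurableType d1) (T2 : measurableType d2).

HB.instance Definition _ :=
  isMeasurableFun.Build _ _ _ _ (@fst T1 T2) measurable_fst.
HB.instance Definition _ :=
  isMeasurableFun.Build _ _ _ _ (@snd T1 T2) measurable_snd.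

Definition mfst : {mfun (T1 * T2)%type >-> T1} := fst.
Definition msnd : {mfun (T1 * T2)%type >-> T2} := snd.

End projections.

Section random_variables.
Context d (Omega : measurableType d) (R : realType) (P : probability Omega R).

Definition law d' (T : measurableType d') (X : {RV P >-> T}) :
  probability T R := distribution P X.

(* Laws are compared with measure_eq, i.e. on measurable sets only: the values
   of a measure on non-measurable sets are not meaningful. *)
Definition has_law d' (T : measurableType d') (X : {RV P >-> T})
  (rho : probability T R) : Prop := measure_eq (law X) rho.

Definition independent2 d1 d2 (T1 : measurableType d1) (T2 : measurableType d2)
    (X : {RV P >-> T1}) (Y : {RV P >-> T2}) : Prop :=
  forall A B, measurable A -> measurable B ->
    P (X @^-1` A `&` Y @^-1` B) = (P (X @^-1` A) * P (Y @^-1` B))%E.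

Definition independent_family d' (T : measurableType d')
    (X : nat -> {RV P >-> T}) : Prop :=
  forall (J : {fset nat}) (B : nat -> set T), (forall k, measurable (B k)) ->
    P (\bigcap_(k in [set` J]) (X k @^-1` B k)) =
    (\prod_(k <- J) P (X k @^-1` B k))%E.

Definition iid_with_law d' (T : measurableType d') (X : nat -> {RV P >-> T})
    (rho : probability T R) : Prop :=
  independent_family X /\ forall k, has_law (X k) rho.

(* X belongs to L^p(Omega; V); random variables are not identified when they
   are almost surely equal. *)
Definition in_L (V : completeNormedModType R) (p : R) (X : {RV P >-> borel V}) :
  Prop := (\int[P]_w (`|X w : V| `^ p)%:E < +oo)%E.

End random_variables.

Arguments law {d Omega R} P {d' T} X.
Arguments has_law {d Omega R} P {d' T} X rho.
Arguments independent2 {d Omega R} P {d1 d2 T1 T2} X Y.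
Arguments independent_family {d Omega R} P {d' T} X.
Arguments iid_with_law {d Omega R} P {d' T} X rho.
Arguments in_L {d Omega R} P {V} p X.

Section problem.
Context d (Omega : measurableType d) (R : realType) (P : probability Omega R).
Context (XX UU WW : completeNormedModType R).
Implicit Types (X : {RV P >-> borel XX}) (U : {RV P >-> borel UU}).
Implicit Types (rho mu nu : probability (borel XX) R).
Implicit Types (pi : {mfun borel XX >-> borel UU}).

Definition in_Pn (n : R) mu : Prop := (\int[mu]_x (`|x : XX| `^ n)%:E < +oo)%E.

Definition in_Gamma (n : R) rho : Prop :=
  in_Pn n rho /\ exists X, in_L P n X /\ has_law P X rho.

Definition in_Pi0 (n l : R) pi : Prop :=
  forall X, in_L P n X -> in_L P l (pi \o X : {RV P >-> borel UU}).

(* dD is a metric on P_n; its values outside P_n are irrelevant. By the triangle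
   inequality the third clause makes dD well defined up to measure_eq. *)
Definition is_metric_on_Pn (n : R)
    (dD : probability (borel XX) R -> probability (borel XX) R -> R) : Prop :=
  [/\ forall mu nu, in_Pn n mu -> in_Pn n nu -> 0 <= dD mu nu,
      forall mu nu, in_Pn n mu -> in_Pn n nu -> dD mu nu = dD nu mu,
      forall mu nu, in_Pn n mu -> in_Pn n nu ->
        (dD mu nu = 0 <-> measure_eq mu nu) &
      forall mu nu rho, in_Pn n mu -> in_Pn n nu -> in_Pn n rho ->
        dD mu rho <= dD mu nu + dD nu rho].

Definition classKoo (alpha : R -> R) : Prop :=
  [/\ {within `[0, +oo[, continuous alpha},
      forall r s, 0 <= r -> r < s -> alpha r < alpha s,
      alpha 0 = 0 &
      forall M, exists2 r, 0 <= r & M < alpha r].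

Section dynamics.
Variable f : {mfun (borel XX * borel UU * borel WW)%type >-> borel XX}.
Variable rhoW : probability (borel WW) R.

Definition ae_continuous_dynamics : Prop :=
  {ae rhoW, forall w, continuous (fun xu : XX * UU => f (xu, w) : XX)}.

(* f (X, pi X, W) for random variables X, W on an arbitrary space *)
Definition next_state d' (S : measurableType d') pi
    (X : {mfun S >-> borel XX}) (W : {mfun S >-> borel WW}) :
  {mfun S >-> borel XX} := f \o mpair (mpair X (pi \o X)) W.

(* The law of f (X, pi X, W) for the coordinates X, W of XX * WW, which under
   the product measure are independent with laws rho and rhoW. *)
Definition transition rho pi : probability (borel XX) R :=
  distribution (rho \x rhoW)%E
    (next_state pi (@mfst _ _ (borel XX) (borel WW)) (@msnd _ _ _ _)).

Definition stationary rho pi : Prop := measure_eq (transition rho pi) rho.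

Fixpoint trajectory (X0 : {RV P >-> borel XX}) (W : nat -> {RV P >-> borel WW})
    (pi : nat -> {mfun borel XX >-> borel UU}) (k : nat) : {RV P >-> borel XX} :=
  if k is k'.+1 then next_state (pi k') (trajectory X0 W pi k') (W k') else X0.

Definition noise_independent_of_trajectories (n l : R) (X0 : {RV P >-> borel XX})
    (W : nat -> {RV P >-> borel WW}) : Prop :=
  forall (pi : nat -> {mfun borel XX >-> borel UU}),
    (forall k, in_Pi0 n l (pi k)) ->
    forall k, let X := trajectory X0 W pi k in
      independent2 P (W k) (mpair X (pi k \o X)).

Section cost.
(* The stage cost is a total function; only its values on YY are ever used. *)
Variables (n l : R) (YY : set ({RV P >-> borel XX} * {RV P >-> borel UU})).
Variable ell : {RV P >-> borel XX} * {RV P >-> borel UU} -> R.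

Definition same_joint_law (XU YV : {RV P >-> borel XX} * {RV P >-> borel UU}) :
  Prop := has_law P (mpair XU.1 XU.2) (law P (mpair YV.1 YV.2)).

Definition law_invariant_set : Prop :=
  forall XU YV, YY XU -> same_joint_law YV XU -> YY YV.

Definition law_invariant_cost : Prop :=
  forall XU YV, YY XU -> YY YV -> same_joint_law XU YV -> ell XU = ell YV.

Definition with_policy X pi : {RV P >-> borel XX} * {RV P >-> borel UU} :=
  (X, pi \o X : {mfun _ >-> _}).

(* A real-valued functional on probability measures: it may not distinguish
   measures that agree on all Borel sets. *)
Definition respects_measure_eq (Lambda : probability (borel XX) R -> R) : Prop :=
  forall mu nu, measure_eq mu nu -> Lambda mu = Lambda nu.

Definition dissipation_inequality rhos pis
    (dD : probability (borel XX) R -> probability (borel XX) R -> R)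
    (Lambda : probability (borel XX) R -> R) (alpha : R -> R) : Prop :=
  forall X pi Xs, in_Pi0 n l pi -> YY (with_policy X pi) -> has_law P Xs rhos ->
    ell (with_policy X pi) - ell (with_policy Xs pis)
      + Lambda (law P X) - Lambda (transition (law P X) pi)
    >= alpha (dD (law P X) rhos).

Definition storage_function (Lambda : probability (borel XX) R -> R) : Prop :=
  respects_measure_eq Lambda /\ exists m, forall mu, m <= Lambda mu.

Definition dissipative rhos pis dD : Prop :=
  exists Lambda, storage_function Lambda /\
    dissipation_inequality rhos pis dD Lambda (fun=> 0).

Definition strictly_dissipative rhos pis dD : Prop :=
  exists Lambda alpha, [/\ storage_function Lambda, classKoo alpha &
    dissipation_inequality rhos pis dD Lambda alpha].

(* The constraints of the stationary problem; its decision variables are rho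
   and pi, and X is any random variable with law rho. *)
Definition feasible rho pi X : Prop :=
  [/\ in_Gamma n rho, in_Pi0 n l pi, has_law P X rho, stationary rho pi &
      YY (with_policy X pi)].

Definition optimal rho pi : Prop :=
  (exists X, feasible rho pi X) /\
  forall X rho' pi' X', feasible rho pi X -> feasible rho' pi' X' ->
    ell (with_policy X pi) <= ell (with_policy X' pi').

End cost.
End dynamics.
End problem.

(* Main.v *)
Require Import Defs.
From HB Require Import structures.
From mathcomp Require Import all_boot all_order all_algebra.
From mathcomp Require Import finmap.
From mathcomp Require Import all_classical all_reals all_analysis.
From mathcomp Require Import giry.
Set Implicit Arguments.
Unset Strict Implicit.
Unset Printing Implicit Defensive.
Import Order.TTheory GRing.Theory Num.Theory.
Import numFieldNormedType.Exports.
Local Open Scope classical_set_scope.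
Local Open Scope ring_scope.

(** At a stationary pair the storage function is evaluated twice at the same
    law: if X has a law rho with T(rho, pi) = rho, then X and its successor
    X^+ have the same law, so Lambda(P_X) - Lambda(P_{X^+}) = 0 and the
    dissipation inequality collapses to

      alpha(d_D(P_X, rho^s)) <= ell(X, pi(X)) - ell(X^s, pi^s(X^s))

    for every feasible point of the stationary problem and every X^s of law
    rho^s ([dissipation_at_feasible]).  With alpha = 0 this is the optimality
    of (rho^s, pi^s).  In the strict case another optimal pair has cost at most
    that of (rho^s, pi^s), hence alpha(d_D(P_X, rho^s)) <= 0; as alpha vanishes
    only at 0, the distance is 0.

    Equality of laws means agreement on measurable sets, whereas the storage
    function and d_D take measures as arguments; the only measure theory in the
    proof is the transfer of moments and of the transition kernel along this
    relation ([in_Pn_measure_eq], [transition_measure_eq]). *)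

Section measure_eq_invariance.
Context (R : realType) (XX UU WW : completeNormedModType R).
Implicit Types mu nu : probability (borel XX) R.

Lemma in_Pn_measure_eq (n : R) mu nu :
  measure_eq mu nu -> in_Pn n mu -> in_Pn n nu.
Proof.
move=> munu; rewrite /in_Pn.
by rewrite (eq_measure_integral nu) // => A mA _; exact: munu.
Qed.

(** The product measure integrates the sections of a set against the first
    factor, and an integral depends only on the values of the measure on
    measurable sets. *)
Lemma transition_measure_eq
    (f : {mfun (borel XX * borel UU * borel WW)%type >-> borel XX})
    (rhoW : probability (borel WW) R) mu nu
    (pi : {mfun borel XX >-> borel UU}) :
  measure_eq mu nu ->
  measure_eq (transition f rhoW mu pi) (transition f rhoW nu pi).
Proof.
move=> munu S _.
rewrite /transition /distribution /pushforward /= /product_measure1.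
by apply: eq_measure_integral => A mA _; exact: munu.
Qed.

End measure_eq_invariance.

Lemma classKoo_le0 (R : realType) (alpha : R -> R) (r : R) :
  classKoo alpha -> 0 <= r -> alpha r <= 0 -> r = 0.
Proof.
move=> [_ alpha_incr alpha0 _] r_ge0 alphar_le0.
apply/eqP; rewrite eq_le r_ge0 andbT leNgt; apply/negP => r_gt0.
by have := alpha_incr 0 r (lexx 0) r_gt0; rewrite alpha0 ltNge alphar_le0.
Qed.

Section stationary_problem.
Context d (Omega : measurableType d) (R : realType) (P : probability Omega R).
Context (XX UU WW : completeNormedModType R).
Variable f : {mfun (borel XX * borel UU * borel WW)%type >-> borel XX}.
Variables (rhoW : probability (borel WW) R) (n l : R).
Variables (YY : set ({RV P >-> borel XX} * {RV P >-> borel UU})).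
Variable ell : {RV P >-> borel XX} * {RV P >-> borel UU} -> R.
Implicit Types (X Xs : {RV P >-> borel XX}) (rho : probability (borel XX) R).
Implicit Types pi : {mfun borel XX >-> borel UU}.

(** The law of X need not be rho as a measure, only agree with it on Borel
    sets; stationarity of rho therefore passes to it through
    T(P_X, pi) = T(rho, pi) = rho = P_X. *)
Lemma feasible_stationary_law rho pi X :
  feasible f rhoW n l YY rho pi X -> stationary f rhoW (law P X) pi.
Proof.
move=> [_ _ Xrho rho_stat _] S mS.
by rewrite (transition_measure_eq f rhoW pi Xrho) // rho_stat // Xrho.
Qed.

Lemma feasible_in_Pn rho pi X :
  feasible f rhoW n l YY rho pi X -> in_Pn n (law P X).
Proof.
move=> [[rho_n _] _ Xrho _ _].
by apply: in_Pn_measure_eq rho_n => S mS; rewrite Xrho.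
Qed.

(** The storage terms of X and of its successor cancel. *)
Lemma dissipation_at_feasible rhos pis dD Lambda (alpha : R -> R) rho pi X Xs :
  respects_measure_eq Lambda ->
  dissipation_inequality f rhoW n l YY ell rhos pis dD Lambda alpha ->
  feasible f rhoW n l YY rho pi X -> has_law P Xs rhos ->
  alpha (dD (law P X) rhos) <=
    ell (with_policy X pi) - ell (with_policy Xs pis).
Proof.
move=> LambdaE diss Xfeas Xsrhos.
have [_ pi0 _ _ XY] := Xfeas.
have := diss X pi Xs pi0 XY Xsrhos.
by rewrite (LambdaE _ _ (feasible_stationary_law Xfeas)) addrK.
Qed.

End stationary_problem.

Theorem mainTheorem6 (R : realType)
  (d : measure_display) (Omega : measurableType d) (P : probability Omega R)
  (XX UU WW : completeNormedModType R)
  (sepX : separable_space XX) (sepU : separable_space UU)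
  (sepW : separable_space WW)
  (n l : R) (n1 : 1 <= n) (l1 : 1 <= l)
  (f : {mfun (borel XX * borel UU * borel WW)%type >-> borel XX})
  (rhoW : probability (borel WW) R)
  (fcont : ae_continuous_dynamics f rhoW)
  (X0 : {RV P >-> borel XX}) (W : nat -> {RV P >-> borel WW})
  (Wiid : iid_with_law P W rhoW)
  (Wind : noise_independent_of_trajectories f n l X0 W)
  (YY : set ({RV P >-> borel XX} * {RV P >-> borel UU}))
  (YYL : forall X U, YY (X, U) -> in_L P n X /\ in_L P l U)
  (YYinv : law_invariant_set YY)
  (ell : {RV P >-> borel XX} * {RV P >-> borel UU} -> R)
  (ellinv : law_invariant_cost YY ell)
  (dD : probability (borel XX) R -> probability (borel XX) R -> R)
  (dDmetric : is_metric_on_Pn n dD)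
  (rhos : probability (borel XX) R) (pis : {mfun borel XX >-> borel UU})
  (rhosG : in_Gamma P n rhos) (pisPi : in_Pi0 P n l pis)
  (stat : stationary f rhoW rhos pis)
  (Ys : forall Xs : {RV P >-> borel XX},
      has_law P Xs rhos -> YY (with_policy Xs pis))
  (diss : dissipative f rhoW n l YY ell rhos pis dD) :
  optimal f rhoW n l YY ell rhos pis /\
  (strictly_dissipative f rhoW n l YY ell rhos pis dD ->
   forall (rho : probability (borel XX) R)
     (pi : {mfun borel XX >-> borel UU}),
     optimal f rhoW n l YY ell rho pi -> dD rhos rho = 0).
Proof.
have feas_s Xs : has_law P Xs rhos -> feasible f rhoW n l YY rhos pis Xs.
  by move=> Xsrhos; split=> //; exact: Ys.
have [rhos_n [Xs [_ Xsrhos]]] := rhosG.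
split.
  split; first by exists Xs; exact: feas_s.
  have [Lambda [[LambdaE _] ineq]] := diss.
  move=> X rho pi X' [_ _ Xrhos _ _] X'feas.
  have := dissipation_at_feasible LambdaE ineq X'feas Xrhos.
  by rewrite subr_ge0.
move=> [Lambda [alpha [[LambdaE _] alphaK ineq]]] rho pi [[X Xfeas] rho_min].
have [[rho_n _] _ Xrho _ _] := Xfeas.
have X_n := feasible_in_Pn Xfeas.
have [dD_ge0 _ dD_eq0 _] := dDmetric.
have dX0 : dD (law P X) rhos = 0.
  apply: classKoo_le0 alphaK (dD_ge0 _ _ X_n rhos_n) _.
  apply: le_trans (dissipation_at_feasible LambdaE ineq Xfeas Xsrhos) _.
  by rewrite subr_le0; exact: rho_min Xfeas (feas_s _ Xsrhos).
have Xrhos : measure_eq (law P X) rhos by apply/dD_eq0.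
by apply/dD_eq0 => // S mS; rewrite -Xrhos // Xrho.
Qed.
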